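(* Let $n\ge 1$ be an integer, let $q$ be a prime power, let $\mathcal{C}\subseteq \mathrm{U}(n,\mathbb{F}_q)$ be a (not necessarily linear) flag-rank-metric code with minimum distance $\delta$, and let $t=\left\lfloor\frac{\delta-1}{2}\right\rfloor$. Then \[ |\mathcal{C}|\, b_q(n,t)\le q^{\frac{n(n+1)}{2}}. \]
   Context: $\mathbb{F}_q$ is the finite field with $q$ elements. $\mathrm{U}(n,\mathbb{F}_q)$ is the $\mathbb{F}_q$-vector space of $n\times n$ upper triangular matrices over $\mathbb{F}_q$. For $M\in \mathrm{U}(n,\mathbb{F}_q)$ and $1\le i\le n$, $M_{[i]}$ is the $i\times(n-i+1)$ submatrix of $M$ obtained by deleting the first $i-1$ columns and the last $n-i$ rows (i.e. rows $1,\dots,i$ and columns $i,\dots,n$). The flag-rank weight of $M$ is $\mathrm{fr}(M)=\sum_{i=1}^{n}\mathrm{rk}(M_{[i]})$; the flag-rank distance $\mathrm{d}_{\mathrm{fr}}(A,B)=\mathrm{fr}(A-B)$ is a metric on $\mathrm{U}(n,\mathbb{F}_q)$. A (not necessarily linear) flag-rank-metric code is a subset $\mathcal{C}\subseteq \mathrm{U}(n,\mathbb{F}_q)$; its minimum distance, defined when $|\mathcal{C}|\ge 2$, is $\delta=\min\{\mathrm{d}_{\mathrm{fr}}(A,B):A,B\in\mathcal{C},\ A\ne B\}$ (so ''with minimum distance $\delta$'' entails $|\mathcal{C}|\ge 2$). The number $b_q(n,t)=|\{A\in \mathrm{U}(n,\mathbb{F}_q):\mathrm{fr}(A)\le t\}|$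 is the size of a flag-rank ball of radius $t$. *)

(* Defs.v *)
From HB Require Import structures.
From mathcomp Require Import all_boot all_order all_algebra.

Set Implicit Arguments.
Unset Strict Implicit.
Unset Printing Implicit Defensive.

Import GRing.Theory.
Local Open Scope ring_scope.

(* MathComp's [is_trig_mx] is lower triangularity, hence the transpose. *)
Definition upper_triangular (F : finFieldType) (n : nat) : {set 'M[F]_n} :=
  [set M : 'M[F]_n | is_trig_mx M^T].

Definition shift_ord (n : nat) (i : 'I_n) (j : 'I_(n - i)) : 'I_n :=
  cast_ord (subnKC (ltnW (ltn_ord i))) (rshift i j).

(* Indices start at 0: for [i : 'I_n] this is the block of rows 0, ..., i and
   columns i, ..., n - 1, which is M_[i+1] in 1-based notation. *)
Definition flag_submx (F : finFieldType) (n : nat) (M : 'M[F]_n) (i : 'I_n) :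
    'M[F]_(i.+1, n - i) :=
  mxsub (widen_ord (ltn_ord i)) (@shift_ord n i) M.

Definition flag_rank (F : finFieldType) (n : nat) (M : 'M[F]_n) : nat :=
  (\sum_(i < n) \rank (flag_submx M i))%N.

Definition flag_rank_dist (F : finFieldType) (n : nat) (A B : 'M[F]_n) : nat :=
  flag_rank (A - B).

(* The minimum is attained, so the code has at least two elements. *)
Definition has_min_distance (F : finFieldType) (n : nat) (C : {set 'M[F]_n})
    (delta : nat) : Prop :=
  (exists A B : 'M[F]_n,
     [/\ A \in C, B \in C, A != B & flag_rank_dist A B = delta]) /\
  (forall A B : 'M[F]_n,
     A \in C -> B \in C -> A != B -> (delta <= flag_rank_dist A B)%N).

Definition flag_rank_ball_size (F : finFieldType) (n t : nat) : nat :=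
  #|[set A in upper_triangular F n | (flag_rank A <= t)%N]|.

(* Main.v *)
(* Adding to a codeword an upper triangular matrix of flag-rank at most t is
   injective on pairs: if A + X = B + Y then A - B = Y - X has flag-rank at most
   2t < delta, so A = B. *)
Require Import Defs.
From HB Require Import structures.
From mathcomp Require Import all_boot all_order all_algebra.

Set Implicit Arguments.
Unset Strict Implicit.

Import GRing.Theory.

Section FlagRank.

Variables (F : finFieldType) (n : nat).
Implicit Types A B M : 'M[F]_n.

(** This is the sphere-packing argument. The balls of radius [t] around codewords lie in the space
    of upper triangular matrices, are translates of the ball around 0, and are pairwise disjoint
    since [2t < delta]. Disjointness rests on subadditivity ([flag_rankB]), the strict inequality on
    separation ([flag_rank_eq0]), and the right-hand side on [card_upper_triangular_le]. *)

Lemma upper_triangularP M :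
  reflect (forall i j : 'I_n, j < i -> M i j = 0%R) (M \in upper_triangular F n).
Proof.
rewrite inE; apply: (iffP is_trig_mxP) => upM i j /upM; first by rewrite mxE.
by move=> Mji; rewrite mxE.
Qed.

Lemma upper_triangularD A B :
  A \in upper_triangular F n -> B \in upper_triangular F n ->
  (A + B)%R \in upper_triangular F n.
Proof.
move=> /upper_triangularP upA /upper_triangularP upB.
by apply/upper_triangularP => i j ltji; rewrite mxE upA // upB // addr0.
Qed.

Lemma upper_triangularB A B :
  A \in upper_triangular F n -> B \in upper_triangular F n ->
  (A - B)%R \in upper_triangular F n.
Proof.
move=> /upper_triangularP upA /upper_triangularP upB.
by apply/upper_triangularP => i j ltji; rewrite !mxE upA // upB // subrr.
Qed.

(** Counted by columns: column [j] contributes the [j.+1] rows [i <= j]. *)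
Lemma card_ord_le_pairs : #|[set p : 'I_n * 'I_n | p.1 <= p.2]| = 'C(n.+1, 2).
Proof.
rewrite -sum1dep_card -(pair_big_dep xpredT (fun i j : 'I_n => i <= j) (fun _ _ => 1)) /=.
rewrite (exchange_big_dep xpredT) //= -bin2_sum big_mkord big_ord_recl add0n.
apply: eq_bigr => j _; rewrite lift0.
by apply: etrans (big_ord_narrow (ltn_ord j)) _; rewrite sum1_card card_ord.
Qed.

(** The entries of a matrix, seen as a function on index pairs, determine it; for an upper
    triangular matrix this function is supported on the pairs with [i <= j]. *)
Lemma card_upper_triangular_le :
  #|upper_triangular F n| <= #|F| ^ (n * n.+1 %/ 2).
Proof.
pose P := [set p : 'I_n * 'I_n | p.1 <= p.2].
have -> : n * n.+1 %/ 2 = #|P| by rewrite card_ord_le_pairs bin2 divn2 mulnC.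
pose entries M := [ffun p : 'I_n * 'I_n => M p.1 p.2].
have entries_inj : injective entries.
  move=> A B eqAB; apply/matrixP => i j.
  by have /ffunP/(_ (i, j)) := eqAB; rewrite !ffunE.
rewrite -(card_pffun_on 0%R (mem P) (mem F)) -(card_imset _ entries_inj).
apply/subset_leq_card/subsetP => _ /imsetP[M /upper_triangularP upM ->].
apply/pffun_onP; split=> //.
apply/supportP => -[i j]; rewrite ffunE inE /= -ltnNge; exact: upM.
Qed.

(** Taking a block is linear and rank is subadditive, so the bound holds block by block. *)
Lemma flag_rankB A B : flag_rank (A - B) <= flag_rank A + flag_rank B.
Proof.
rewrite -big_split; apply: leq_sum => i _ /=.
have -> : flag_submx (A - B) i = (flag_submx A i + - flag_submx B i)%R.
  by apply/matrixP => j k; rewrite !mxE.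
by rewrite -[\rank (flag_submx B i)]mxrank_opp mxrank_add.
Qed.

(** All blocks vanish, and an entry [(i, j)] with [i <= j] sits in block [i], in its last row and
    column [j - i]. *)
Lemma flag_rank_eq0 M :
  M \in upper_triangular F n -> flag_rank M = 0 -> M = 0%R.
Proof.
move=> /upper_triangularP upM frM; apply/matrixP => i j; rewrite [RHS]mxE.
have [/upM //|leij] := ltnP j i.
have ltji : j - i < n - i by rewrite ltn_sub2r.
have /eqP := frM; rewrite sum_nat_eq0 => /forallP/(_ i); rewrite mxrank_eq0.
move=> /eqP/matrixP/(_ ord_max (Ordinal ltji)); rewrite !mxE => <-.
by congr (M _ _); apply: val_inj; rewrite //= subnKC.
Qed.

End FlagRank.

Lemma min_distance_gt0 (F : finFieldType) (n : nat) (C : {set 'M[F]_n})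
    (delta : nat) :
  C \subset upper_triangular F n -> has_min_distance C delta -> 0 < delta.
Proof.
move=> /subsetP upC [[A [B [CA CB neqAB <-]]] _]; rewrite lt0n.
apply: contra neqAB => /eqP /flag_rank_eq0 AB0.
by rewrite -subr_eq0 AB0 // upper_triangularB ?upC.
Qed.

Theorem theorem4p1 (n q : nat) (hn : 0 < n) (F : finFieldType) (hq : #|F| = q)
    (C : {set 'M[F]_n}) (hC : C \subset upper_triangular F n)
    (delta : nat) (hdelta : has_min_distance C delta)
    (t : nat) (ht : t = (delta - 1) %/ 2) :
  #|C| * flag_rank_ball_size F n t <= q ^ (n * (n + 1) %/ 2).
Proof.
have delta_gt0 := min_distance_gt0 hC hdelta.
have ltt_delta : t + t < delta.
  (* Subtraction on [nat] truncates, so positivity of [delta] is what gives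
     [2t <= delta - 1 < delta]. *)
  by rewrite addnn -muln2 ht -{2}(subnK delta_gt0) addn1 ltnS leq_trunc_div.
rewrite -hq addn1 /flag_rank_ball_size -cardsX.
apply: leq_trans (@card_upper_triangular_le F n).
rewrite -(@card_in_imset _ _ (fun p => p.1 + p.2)%R).
  apply/subset_leq_card/subsetP => _ /imsetP[[A X] /setXP[CA /setIdP[upX _]] ->].
  by apply: upper_triangularD => //; apply: (subsetP hC).
move=> [A X] [B Y] /setXP[CA /setIdP[_ frX]] /setXP[CB /setIdP[_ frY]] /= eqAB.
have [eqAB'|neqAB] := eqVneq A B.
  by move: eqAB; rewrite eqAB' => /addrI ->.
(* Distinct centres would be at distance at least [delta], yet [A - B = Y - X] has flag-rank at most
   [2t]. *)
have := hdelta.2 _ _ CA CB neqAB; rewrite leqNgt => /negP[].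
have dAB : (A - B = Y - X)%R.
  by apply/eqP; rewrite subr_eq addrAC eq_sym subr_eq addrC eqAB.
rewrite /flag_rank_dist dAB; apply: leq_ltn_trans ltt_delta.
by apply: leq_trans (flag_rankB _ _) (leq_add frY frX).
Qed.
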